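(* Let $\Omega \subset \mathbb{R}^q$ be a bounded domain with volume $|\Omega| > 0$, let $\omega : \Omega \to [0,\infty)$ be integrable, and let $d \in \mathbb{N}_0$. Let $(\mathbf{x}_n)_{n \in \mathbb{N}}$ be a sequence of distinct points in $\Omega$. Let $N_0 \in \mathbb{N}_0$ be such that $X_{N_0} = \{\mathbf{x}_n\}_{n=1}^{N_0} \subset \Omega$ is $\mathbb{P}_d(\mathbb{R}^q)$-unisolvent and $\omega(\mathbf{x}_n) > 0$ for $n = 1,\dots,N_0$. Moreover, for $N > N_0$, let $X_N = X_{N_0} \cup \{\mathbf{x}_n\}_{n=N_0+1}^{N}$ and $r_n = \omega(\mathbf{x}_n)|\Omega|/N$ for $n=1,\dots,N$. Assume that $$\lim_{N \to \infty} \frac{|\Omega|}{N} \sum_{n=1}^N u(\mathbf{x}_n) v(\mathbf{x}_n) \omega(\mathbf{x}_n) = \int_\Omega u(\boldsymbol{x}) v(\boldsymbol{x}) \omega(\boldsymbol{x}) \, \mathrm{d}\boldsymbol{x} \quad \text{for all } u,v \in \mathbb{P}_d(\mathbb{R}^q).$$ Then there exists an $N_1 \geq N_0$ such that for all $N \geq N_1$ the cubature weights $\mathbf{w}^{\mathrm{LS}} = (w_1^{\mathrm{LS}},\dots,w_N^{\mathrm{LS}})^T$ of the least squares cubature formula (LS-CF) with degree of exactness $d$ on the data points $X_N$ are all nonnegative.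
   Context: $\mathbb{P}_d(\mathbb{R}^q)$ is the vector space of real polynomials in $q$ variables of total degree at most $d$, and $K = \dim \mathbb{P}_d(\mathbb{R}^q) = \binom{d+q}{q}$. A set of points $X = \{\mathbf{x}_n\}_{n=1}^N \subset \mathbb{R}^q$ is called $\mathbb{P}_d(\mathbb{R}^q)$-unisolvent if the only $p \in \mathbb{P}_d(\mathbb{R}^q)$ with $p(\mathbf{x}_n) = 0$ for $n=1,\dots,N$ is $p \equiv 0$. Let $I[f] = \int_\Omega f(\boldsymbol{x})\omega(\boldsymbol{x})\,\mathrm{d}\boldsymbol{x}$. Let $\{p_k\}_{k=1}^K$ be a basis of $\mathbb{P}_d(\mathbb{R}^q)$, let $P = (p_k(\mathbf{x}_n))_{k=1,\dots,K;\; n=1,\dots,N} \in \mathbb{R}^{K \times N}$, let $\mathbf{m} = (I[p_1],\dots,I[p_K])^T$, and let $W = \{\mathbf{w} \in \mathbb{R}^N \mid P\mathbf{w} = \mathbf{m}\}$; this is the set of weight vectors for which the cubature formula $C_N[f] = \sum_{n=1}^N w_n f(\mathbf{x}_n)$ has degree of exactness $d$, i.e. $C_N[f] = I[f]$ for all $f \in \mathbb{P}_d(\mathbb{R}^q)$. With $R = \mathrm{diag}(r_1,\dots,r_N)$, $r_n = \omega(\mathbf{x}_n)|\Omega|/N$, the weights of the LS-CF with degree of exactness $d$ are $$\mathbf{w}^{\mathrm{LS}} = \operatorname*{arg\,min}_{\mathbf{w} \in W} \| R^{-1/2}\mathbf{w} \|_2, \qquad \text{explicitly} \qquad \mathbf{w}^{\mathrm{LS}}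 = R P^T (P R P^T)^{-1}\mathbf{m}.$$ The explicit formula is to be taken as the definition of $\mathbf{w}^{\mathrm{LS}}$ if some $r_n$ with $n > N_0$ vanish (so that $R^{-1/2}$ is not defined). The weights do not depend on the choice of basis $\{p_k\}$. *)

(* Defs.v *)
From HB Require Import structures.
From mathcomp Require Import all_boot all_order all_algebra.
(* The notations of mpoly clash with those of mathcomp-analysis. *)
From mathcomp Require Import -(notations) mpoly.
From mathcomp Require Import all_classical all_reals all_analysis.

Set Implicit Arguments.
Unset Strict Implicit.
Unset Printing Implicit Defensive.
Import Order.TTheory GRing.Theory Num.Theory.
Import numFieldNormedType.Exports.

Local Open Scope classical_set_scope.
Local Open Scope ring_scope.

(* Lebesgue measure on R^q, for q-tuples of reals: first the product measure on
   the Borel sigma-algebra, by recursion on q along (x, t) |-> x :: t. *)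

(* The library's instance for this is shadowed by the one for subprobability
   measures and is not found by inference. *)
Lemma sigma_finite_product_measure d1 d2 (T1 : measurableType d1)
    (T2 : measurableType d2) (R : realType)
    (m1 : {sigma_finite_measure set T1 -> \bar R})
    (m2 : {sigma_finite_measure set T2 -> \bar R}) :
  sigma_finite setT (m1 \x m2)%E.
Proof.
have /sigma_finiteP[F [TF ndF Foo]] := sigma_finiteT m1.
have /sigma_finiteP[G [TG ndG Goo]] := sigma_finiteT m2.
exists (fun n => F n `*` G n).
  rewrite -setXTT TF TG predeqE => -[x y]; split.
    move=> [/= [n _ Fnx] [k _ Gky]]; exists (maxn n k) => //; split.
    - by move: x Fnx; exact/subsetPset/ndF/leq_maxl.
    - by move: y Gky; exact/subsetPset/ndG/leq_maxr.
  by move=> [n _ []/= ? ?]; split; exists n.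
move=> k; have [? ?] := Foo k; have [? ?] := Goo k.
split; first exact: measurableX.
by rewrite product_measure1E// lte_mul_pinfty// ge0_fin_numE.
Qed.

Section cons_measure.
Context (R : realType) (n : nat).
Variable m : {sigma_finite_measure set (n.-tuple (measurableTypeR R)) -> \bar R}.

Definition tcons (xt : measurableTypeR R * n.-tuple (measurableTypeR R)) :
  n.+1.-tuple (measurableTypeR R) := [tuple of xt.1 :: xt.2].

Lemma measurable_tcons : measurable_fun setT tcons.
Proof. exact: measurable_cons. Qed.

Definition cons_measure : set (n.+1.-tuple (measurableTypeR R)) -> \bar R :=
  pushforward (@lebesgue_measure R \x m)%E tcons.

Let pushE (A : set (n.+1.-tuple (measurableTypeR R))) :
  cons_measure A = (@lebesgue_measure R \x m)%E (tcons @^-1` A).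
Proof. by []. Qed.

Let measurable_pre (A : set (n.+1.-tuple (measurableTypeR R))) :
  measurable A -> measurable (tcons @^-1` A).
Proof.
by move=> mA; rewrite -[X in measurable X]setTI; exact: measurable_tcons.
Qed.

Let cons_measure0 : cons_measure set0 = 0%E.
Proof. by rewrite pushE preimage_set0 measure0. Qed.

Let cons_measure_ge0 A : (0 <= cons_measure A)%E.
Proof. by rewrite pushE. Qed.

Let cons_measure_sigma_additive : semi_sigma_additive cons_measure.
Proof.
move=> F mF tF mUF; rewrite pushE preimage_bigcup.
apply: (@measure_semi_sigma_additive _ _ _ (@lebesgue_measure R \x m)%E
  (fun k => tcons @^-1` F k)).
- by move=> k; exact: measurable_pre.
- apply/trivIsetP => /= i j _ _ ij; rewrite -preimage_setI.
  by move/trivIsetP : tF => /(_ _ _ _ _ ij) -> //; rewrite preimage_set0.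
- by rewrite -preimage_bigcup; exact: measurable_pre.
Qed.

HB.instance Definition _ := isMeasure.Build _ _ _ cons_measure
  cons_measure0 cons_measure_ge0 cons_measure_sigma_additive.

Let cons_measure_sigma_finite : sigma_finite setT cons_measure.
Proof.
pose u (y : n.+1.-tuple (measurableTypeR R)) :
  measurableTypeR R * n.-tuple (measurableTypeR R) :=
    (thead y, [tuple of behead y]).
have mu_ : measurable_fun setT u.
  apply/measurable_fun_pairP; split=> /=.
    exact: measurable_tnth.
  exact: measurable_behead.
have uK : cancel tcons u.
  by case=> x t; rewrite /u /tcons/=; congr pair; exact: val_inj.
have [F TF mF] : sigma_finite setT (@lebesgue_measure R \x m)%E.
  exact: sigma_finite_product_measure.
exists (fun k => u @^-1` F k); first by rewrite -preimage_bigcup -TF preimage_setT.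
move=> k; have [mFk Fkoo] := mF k; split.
  by rewrite -[X in measurable X]setTI; exact: mu_.
rewrite pushE (_ : _ @^-1` _ = F k) //.
by apply/seteqP; split => z /=; rewrite uK.
Qed.

HB.instance Definition _ := Measure_isSigmaFinite.Build _ _ _ cons_measure
  cons_measure_sigma_finite.

End cons_measure.

Fixpoint borel_lebesgue (R : realType) (q : nat) :
    {sigma_finite_measure set (q.-tuple (measurableTypeR R)) -> \bar R} :=
  if q is q'.+1 then cons_measure (borel_lebesgue R q')
  else \d_([tuple] : 0.-tuple (measurableTypeR R)).

(* Points of R^q with the Lebesgue-measurable (Caratheodory) sets, and the
   completion of the product measure. *)
Definition points (R : realType) (q : nat) : Type :=
  caratheodory_type (borel_lebesgue R q)^*%mu.
HB.instance Definition _ (R : realType) (q : nat) :=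
  Measurable.on (points R q).

Definition lebesgue (R : realType) (q : nat) : set (points R q) -> \bar R :=
  @completed_measure_extension _ _ _ (borel_lebesgue R q).
HB.instance Definition _ (R : realType) (q : nat) :=
  Measure.on (@lebesgue R q).

Section integration.
Context (R : realType) (q : nat).
Implicit Types (Omega : set (points R q)) (f omega : points R q -> R).

Definition volume Omega : R := fine (lebesgue Omega).

(* Boundedness for the sup norm, equivalently for any norm on R^q. *)
Definition bounded_points Omega : Prop :=
  exists M : R, forall y, Omega y -> forall i, `|tnth y i| <= M.

Definition weighted_integral Omega omega f : R :=
  \int[@lebesgue R q]_(y in Omega) (f y * omega y).

End integration.

Section polynomials.
Context (R : realType) (q : nat).
Implicit Types (p f : mpoly q R) (x : nat -> points R q).

Definition evalp p (y : points R q) : R := meval (tnth y) p.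

(* [mmeasure mdeg p] is the total degree plus one, and 0 for p = 0. *)
Definition degree_le (d : nat) p : Prop := (mmeasure mdeg p <= d.+1)%N.

(* The sequence x is indexed from 0: its first N points are x 0, ..., x (N-1). *)
Definition unisolvent (d N : nat) x : Prop :=
  forall p, degree_le d p -> (forall n, (n < N)%N -> evalp p (x n) = 0) ->
    p = 0.

Definition is_basis (d K : nat) (p : 'I_K -> mpoly q R) : Prop :=
  [/\ forall k, degree_le d (p k),
      forall c : 'I_K -> R, \sum_(k < K) c k *: p k = 0 -> forall k, c k = 0
    & forall f, degree_le d f ->
        exists c : 'I_K -> R, f = \sum_(k < K) c k *: p k].

Definition colloc_mx (K : nat) (p : 'I_K -> mpoly q R) (N : nat) x :
  'M[R]_(K, N) := \matrix_(k < K, n < N) evalp (p k) (x n).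

Definition moments (K : nat) (p : 'I_K -> mpoly q R)
    (Omega : set (points R q)) (omega : points R q -> R) : 'cV[R]_K :=
  \col_(k < K) weighted_integral Omega omega (evalp (p k)).

Definition ls_ratios (Omega : set (points R q)) (omega : points R q -> R)
    (N : nat) x : 'rV[R]_N :=
  \row_(n < N) (omega (x n) * volume Omega / N%:R).

End polynomials.

Section least_squares.
Context (R : realType) (K N : nat).
Implicit Types (r : 'rV[R]_N) (P : 'M[R]_(K, N)) (m : 'cV[R]_K).
Implicit Types (v w : 'cV[R]_N).

Definition exact_weights P m : set 'cV[R]_N := [set w | P *m w = m].

(* The norm that the library puts on matrices is the sup norm. *)
Definition norm2 v : R := Num.sqrt (\sum_(n < N) v n 0 ^+ 2).

Definition inv_sqrt_diag r : 'M[R]_N :=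
  diag_mx (\row_(n < N) (Num.sqrt (r 0 n))^-1).

Definition is_argmin (g : 'cV[R]_N -> R) (W : set 'cV[R]_N) w : Prop :=
  W w /\ forall w', W w' -> g w <= g w'.

Definition gram_mx r P : 'M[R]_K := P *m diag_mx r *m P^T.

Definition ls_formula r P m : 'cV[R]_N :=
  diag_mx r *m P^T *m invmx (gram_mx r P) *m m.

(* The minimization problem makes sense only when every r_n is positive;
   otherwise the weights are given by the explicit formula. *)
Definition is_ls_weights r P m w : Prop :=
  if [forall n, 0 < r 0 n]
  then is_argmin (fun w => norm2 (inv_sqrt_diag r *m w)) (exact_weights P m) w
  else gram_mx r P \in unitmx /\ w = ls_formula r P m.

End least_squares.

(* Main.v *)
Require Import Defs.
From HB Require Import structures.
From mathcomp Require Import all_boot all_order all_algebra.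
From mathcomp Require Import -(notations) mpoly.
From mathcomp Require Import all_classical all_reals all_analysis.
From mathcomp Require Import measurable_realfun perm ring.

Set Implicit Arguments.
Unset Strict Implicit.
Unset Printing Implicit Defensive.
Import Order.TTheory GRing.Theory Num.Theory.
Import numFieldNormedType.Exports.

Local Open Scope classical_set_scope.
Local Open Scope ring_scope.

(** Let [I] be the weighted integral over the domain, and fix a basis [b] of the
    polynomials of degree at most [d].  The least squares weights are
    [w_n = r_n h_N(x_n)], where [h_N] is the polynomial of degree at most [d]
    whose discrete inner products with the [b_k] are the moments
    (lemma [is_ls_weights_unique]).  Since [I[b_k]] is the continuous inner
    product of [b_k] with the constant 1, and the discrete inner products
    converge to the continuous one, [h_N] converges to 1; on a bounded domain
    this is uniform, so [h_N] is eventually positive at all the points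
    (lemma [ls_formula_eventually_ge0]).  Unisolvence makes every discrete Gram
    matrix invertible from [N0] on, even where some ratios vanish
    (lemma [gram_mx_colloc_unit]).

    The convergence of [h_N] requires the limit inner product to be definite.
    If it is not, some nonzero [p] of degree at most [d] has [I[p^2] = 0].
    Since the zeros of [p] form a null set
    (lemma [borel_lebesgue_meval_zeros]), [omega] vanishes almost everywhere, so
    all the moments are zero and the weights are zero too
    (lemma [weighted_integral_sqr_eq0]).

    The index from which the weights are nonnegative must not depend on the
    basis; this holds because the weights themselves do not
    (lemma [ls_formula_base_change]). *)

(** * Zero sets of polynomials are null *)

Lemma finite_horner_zeros (R : idomainType) (c : {poly R}) :
  c != 0 -> finite_set [set x | c.[x] = 0].
Proof.
move=> c_neq0; apply: contrapT => /(infinite_set_fset (size c))[rs rsP].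
rewrite leqNgt => /negP; apply; apply: max_poly_roots => //.
  by apply/allP => x /rsP/rootP.
exact: finmap.fset_uniq.
Qed.

(** Freezing the first variable of [p] at [a] gives [slice p a].  Each of its
    coefficients is a univariate polynomial in [a], which reduces null sets of
    zeros to dimension one. *)
Section slice.
Context (R : comNzRingType) (n : nat).
Implicit Type p : mpoly n.+1 R.

Definition mnm_tail (m : multinom n.+1) : multinom n :=
  Multinom [tuple m (lift ord0 i) | i < n].

Definition slice p (a : R) : mpoly n R :=
  \sum_(m <- msupp p) (mcoeff m p * a ^+ m ord0) *: mpolyX R (mnm_tail m).

Lemma meval_slice p (a : R) (t : n.-tuple R) :
  meval (tnth t) (slice p a) = meval (tnth (cons_tuple a t)) p.
Proof.
rewrite [RHS]mevalE /slice raddf_sum/=; apply: eq_bigr => m _.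
rewrite mevalZ mevalX big_ord_recl mulrA tnth0; congr (_ * _).
by apply: eq_bigr => i _; rewrite mnmE tnthS.
Qed.

(** A monomial [m] of [p] is determined by its exponent on the first variable
    and its tail.  So, in the coefficient of the tail, nothing can cancel the
    contribution of [m]. *)
Lemma slice_coef p (m : multinom n.+1) : m \in msupp p ->
  exists2 c : {poly R}, c != 0 & forall a, mcoeff (mnm_tail m) (slice p a) = c.[a].
Proof.
move=> mp.
exists (\sum_(k <- msupp p | mnm_tail k == mnm_tail m) mcoeff k p *: 'X^(k ord0)).
  apply/eqP => /(congr1 (fun c : {poly R} => c`_(m ord0))).
  rewrite coef_sum coef0 big_mkcond (bigD1_seq m)//= ?msupp_uniq//.
  rewrite eqxx coefZ coefXn eqxx mulr1 big1 ?addr0.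
    by apply/eqP; rewrite -mcoeff_msupp.
  move=> k kNm; case: eqP => // km; rewrite coefZ coefXn.
  case: eqP => [mk|]; last by rewrite mulr0.
  case/eqP: kNm; apply/mnmP => i; case: (unliftP ord0 i) => [j ->|-> //].
  by have := congr1 (fun t : multinom n => t j) km; rewrite !mnmE.
move=> a; rewrite /slice raddf_sum/= horner_sum [RHS]big_mkcond/=.
apply: eq_bigr => k _; rewrite mcoeffZ mcoeffX hornerZ hornerXn.
by case: eqP; rewrite ?mulr1 ?mulr0.
Qed.

End slice.

Section polynomial_measurability.
Context (R : realType).

Lemma measurable_meval (q : nat) (p : mpoly q R) :
  measurable_fun setT
    (fun y : q.-tuple (measurableTypeR R) => meval (tnth y) p : R).
Proof.
under eq_fun do rewrite mevalE.
apply: measurable_sum => m; apply: measurable_funM; first exact: measurable_cst.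
apply: measurable_prod => i _; apply: measurable_funX.
exact: (@measurable_tnth _ (measurableTypeR R)).
Qed.

Lemma measurable_meval_zeros (q : nat) (p : mpoly q R) :
  measurable [set y : q.-tuple (measurableTypeR R) | meval (tnth y) p = 0].
Proof.
rewrite -[X in measurable X]setTI.
exact: (measurable_meval p measurableT (measurable_set1 0)).
Qed.

(** By Tonelli it suffices that almost every section of the zero set is null.
    The section at [a] is the zero set of [slice p a], which is nonzero unless
    [a] is one of the finitely many roots of some fixed coefficient. *)
Lemma borel_lebesgue_meval_zeros (q : nat) (p : mpoly q R) : p != 0 ->
  borel_lebesgue R q [set y | meval (tnth y) p = 0] = 0%E.
Proof.
elim: q p => [|n IH] p p_neq0.
  rewrite /= diracE (_ : _ \in _ = false)//; apply/negbTE; rewrite notin_setE /=.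
  rewrite (nvar0_mpolyC p) mevalC => c0; case/eqP: p_neq0.
  by rewrite (nvar0_mpolyC p) c0 mpolyC0.
have [m mp] : exists m, m \in msupp p.
  case E : (msupp p) => [|m s]; last by exists m; rewrite mem_head.
  by move/eqP: E; rewrite msupp_eq0 (negbTE p_neq0).
have [c c_neq0 cE] := slice_coef mp.
rewrite /= /cons_measure /pushforward /product_measure1.
rewrite (@ae_eq_integral _ _ _ _ setT (cst 0%E))//.
- by rewrite integral0.
- apply: measurable_fun_xsection.
  rewrite -[X in measurable X]setTI.
  by apply: measurable_tcons => //; exact: measurable_meval_zeros.
exists [set a | c.[a] = 0]; split.
- apply: countable_measurable; first exact: measurable_set1.
  exact: finite_set_countable (finite_horner_zeros c_neq0).
- apply: countable_lebesgue_measure0.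
  exact: finite_set_countable (finite_horner_zeros c_neq0).
move=> a /= /not_implyP[_] nz; apply: contrapT => ca; apply: nz.
have sl_neq0 : slice p a != 0.
  apply/eqP => sl0; apply: ca; rewrite -cE sl0.
  exact: mcoeff0.
rewrite -[RHS](IH _ sl_neq0); congr (borel_lebesgue R n _).
apply/seteqP; split=> t; by rewrite /xsection /= ?inE/= meval_slice.
Qed.

End polynomial_measurability.

Section lebesgue_facts.
Context (R : realType) (q : nat).
Implicit Type p : mpoly q R.

Lemma lebesgue_borel (A : set (q.-tuple (measurableTypeR R))) :
  measurable A -> lebesgue (A : set (points R q)) = borel_lebesgue R q A.
Proof. exact: measurable_mu_extE. Qed.

Lemma measurable_evalp p (D : set (points R q)) :
  measurable D -> measurable_fun D (evalp p).
Proof.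
move=> mD; apply: measurable_funTS => _ Y mY.
apply: caratheodory_measurable_mu_ext.
exact: (measurable_meval p measurableT mY).
Qed.

Lemma lebesgue_evalp_zeros p : p != 0 ->
  lebesgue ([set y | evalp p y = 0] : set (points R q)) = 0%E.
Proof.
move=> p_neq0; rewrite -[RHS](borel_lebesgue_meval_zeros p_neq0).
by apply: lebesgue_borel; exact: measurable_meval_zeros.
Qed.

End lebesgue_facts.

(** * Integrals over a bounded domain *)

Definition box (R : realType) (M : R) n : set (n.-tuple (measurableTypeR R)) :=
  [set y | forall i, `|tnth y i| <= M].
Arguments box {R} M n _.

Section boxes.
Context (R : realType) (M : R).

Lemma measurable_box n : measurable (box M n).
Proof.
rewrite (_ : @box R M n = \big[setI/setT]_(i < n)
    ((fun y => tnth y i) @^-1` [set` `[- M, M]])).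
  apply: bigsetI_measurable => i _; rewrite -[X in measurable X]setTI.
  exact: (@measurable_tnth _ (measurableTypeR R) n i measurableT _
            (measurable_itv `[- M, M])).
apply/seteqP; split => y /=.
  by move=> yM; rewrite -bigcap_seq => i _ /=; rewrite in_itv/= -ler_norml.
rewrite -bigcap_seq => yM i; have := yM i (mem_index_enum i).
by rewrite /= in_itv/= -ler_norml.
Qed.

Lemma borel_lebesgue_box n : (borel_lebesgue R n (box M n) < +oo)%E.
Proof.
elim: n => [|n IH]; first by rewrite /= diracE ltry.
rewrite /= /cons_measure /pushforward.
rewrite (_ : _ @^-1` _ = [set` `[- M, M]] `*` box M n).
  rewrite product_measure1E; last 2 first.
  - exact: (measurable_itv `[- M, M]).
  - exact: measurable_box.
  rewrite lte_mul_pinfty//.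
  by rewrite /= lebesgue_measure_itv/=; case: ifP.
apply/seteqP; split=> -[a t] /=.
  move=> atM; split.
    by have := atM ord0; rewrite tnth0 in_itv/= ler_norml.
  by move=> i; have := atM (lift ord0 i); rewrite tnthS.
rewrite in_itv/= -ler_norml => -[aM tM] i; case: (unliftP ord0 i) => [j ->|->].
  by rewrite tnthS.
by rewrite tnth0.
Qed.

End boxes.

Section bounded_domain.
Context (R : realType) (q : nat).
Implicit Types (p u : mpoly q R) (Omega : set (points R q)).
Implicit Type omega : points R q -> R.

(** The volume is the real part of an extended measure, so positivity also
    needs finiteness, which comes from an enclosing box. *)
Lemma volume_gt0 Omega : measurable Omega -> bounded_points Omega ->
  (0 < lebesgue Omega)%E -> 0 < volume Omega.
Proof.
move=> mO [M OM] O_gt0; rewrite /volume fine_gt0// O_gt0/=.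
apply: le_lt_trans (borel_lebesgue_box M q).
rewrite -lebesgue_borel; last exact: measurable_box.
apply: le_measure; rewrite ?inE//.
by apply: caratheodory_measurable_mu_ext; exact: measurable_box.
Qed.

Lemma bounded_evalp Omega p : bounded_points Omega ->
  exists2 C, 0 <= C & forall y, Omega y -> `|evalp p y| <= C.
Proof.
move=> [M OM].
exists (\sum_(m <- msupp p) `|mcoeff m p| * \prod_(i < q) `|M| ^+ m i).
  by apply: sumr_ge0 => m _; rewrite mulr_ge0// prodr_ge0.
move=> y Oy; rewrite /evalp mevalE; apply: le_trans (ler_norm_sum _ _ _) _.
apply: ler_sum => m _; rewrite normrM ler_wpM2l// normr_prod.
apply: ler_prod => i _; rewrite normr_ge0/= normrX lerXn2r ?nnegrE//.
exact: le_trans (OM y Oy i) (ler_norm M).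
Qed.

Lemma integrable_evalpM Omega omega p :
  measurable Omega -> bounded_points Omega ->
  (@lebesgue R q).-integrable Omega (EFin \o omega) ->
  (@lebesgue R q).-integrable Omega (fun y => (evalp p y * omega y)%:E).
Proof.
move=> mO bO io; have [C C0 pC] := bounded_evalp p bO.
apply: (integrableMr mO (measurable_evalp p mO) _ io).
exists C; split; first exact: ger0_real.
by move=> x Cx y Oy; apply: le_trans (pC y Oy) (ltW Cx).
Qed.

(** The product of [p ^+ 2] and [omega] has zero integral and is nonnegative,
    so it vanishes almost everywhere; as the zeros of [p] are null, [omega]
    itself vanishes almost everywhere, and then so does every integral against
    it.  Thus the bilinear form of the integral is either definite or comes
    with zero moments. *)
Lemma weighted_integral_sqr_eq0 Omega omega p u :
  measurable Omega -> bounded_points Omega ->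
  (forall y, Omega y -> 0 <= omega y) ->
  (@lebesgue R q).-integrable Omega (EFin \o omega) ->
  p != 0 -> weighted_integral Omega omega (fun y => evalp p y * evalp p y) = 0 ->
  weighted_integral Omega omega (evalp u) = 0.
Proof.
move=> mO bO o_ge0 io p_neq0 pp0.
have ipp : (@lebesgue R q).-integrable Omega
    (fun y => (evalp p y * evalp p y * omega y)%:E).
  under eq_fun do rewrite /evalp -mevalM -/(evalp _ _).
  exact: integrable_evalpM.
have mpp := measurable_int _ ipp.
have iu := integrable_evalpM u mO bO io.
have : (\int[@lebesgue R q]_(y in Omega)
    `|(evalp p y * evalp p y * omega y)%:E| = 0)%E.
  rewrite -[RHS]/(0%:E) -pp0 /weighted_integral /Rintegral fineK.
    apply: eq_integral => y /set_mem Oy; rewrite gee0_abs// lee_fin.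
    by rewrite mulr_ge0// ?o_ge0// -expr2 sqr_ge0.
  exact: integrable_fin_num.
move=> /(ae_eq_integral_abs _ mO mpp).1 [Z [mZ Z0 pZ]].
rewrite /weighted_integral /Rintegral (@ae_eq_integral _ _ _ _ _ (cst 0%E)).
- by rewrite integral0.
- exact: mO.
- exact: measurable_int iu.
- exact: measurable_cst.
exists (Z `|` [set y | evalp p y = 0]); split.
- apply: measurableU => //.
  by apply: caratheodory_measurable_mu_ext; exact: measurable_meval_zeros.
- rewrite [LHS]measureU0//.
    by apply: caratheodory_measurable_mu_ext; exact: measurable_meval_zeros.
  exact: lebesgue_evalp_zeros.
move=> y /= /not_implyP[Oy /= uo].
have [py|py] := eqVneq (evalp p y) 0; [by right|left].
apply: pZ => /= /(_ Oy) [] /eqP.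
rewrite !mulf_eq0 !(negbTE py)/= => /eqP oy; apply: uo.
by rewrite oy mulr0.
Qed.

End bounded_domain.

(** * The least squares weights *)

Section least_squares_formula.
Context (R : realType) (K N : nat).
Implicit Types (r : 'rV[R]_N) (P : 'M[R]_(K, N)) (m a : 'cV[R]_K).

Lemma mul_gram_mx r P (u v : 'rV[R]_K) :
  (u *m gram_mx r P *m v^T) 0 0 = \sum_n r 0 n * ((u *m P) 0 n * (v *m P) 0 n).
Proof.
rewrite /gram_mx !mulmxA -mulmxA -trmx_mul mxE; apply: eq_bigr => n _.
by rewrite mul_mx_diag !mxE mulrCA mulrA.
Qed.

(** The quadratic form of the Gram matrix is the sum of squares
    [\sum_n r 0 n * (v *m P) 0 n ^+ 2]. *)
Lemma gram_mx_ker r P (v : 'rV[R]_K) : (forall n, 0 <= r 0 n) ->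
  v *m gram_mx r P = 0 -> forall n, 0 < r 0 n -> (v *m P) 0 n = 0.
Proof.
move=> r_ge0 vG0 n rn_gt0.
have /eqP := mul_gram_mx r P v v; rewrite vG0 mul0mx mxE eq_sym psumr_eq0.
  move=> /allP/(_ n (mem_index_enum n)).
  by rewrite -expr2 mulf_eq0 gt_eqF//= sqrf_eq0 => /eqP.
by move=> i _; rewrite mulr_ge0// -expr2 sqr_ge0.
Qed.

Lemma ls_formulaE r P m a : gram_mx r P \in unitmx -> gram_mx r P *m a = m ->
  ls_formula r P m = diag_mx r *m P^T *m a.
Proof. by move=> Gu <-; rewrite /ls_formula -[LHS]mulmxA mulKmx. Qed.

(** If [a] solves the normal equations for [P] and [m], then
    [invmx B^T *m a] solves them for [B *m P] and [B *m m], and [P^T *m a] is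
    unchanged. *)
Lemma ls_formula_base_change (B : 'M[R]_K) r P m :
  B \in unitmx -> gram_mx r P \in unitmx ->
  ls_formula r (B *m P) (B *m m) = ls_formula r P m.
Proof.
move=> Bu Gu; have BTu : B^T \in unitmx by rewrite unitmx_tr.
have GB : gram_mx r (B *m P) = B *m gram_mx r P *m B^T.
  by rewrite /gram_mx trmx_mul !mulmxA.
have [a Ga] : exists a, gram_mx r P *m a = m.
  by exists (invmx (gram_mx r P) *m m); rewrite mulKVmx.
rewrite (ls_formulaE Gu Ga) (@ls_formulaE _ _ _ (invmx B^T *m a)).
- by rewrite trmx_mul -!mulmxA mulKVmx.
- by rewrite GB !unitmx_mul Bu Gu.
- by rewrite GB -[LHS]mulmxA mulKVmx// -mulmxA Ga.
Qed.

Lemma norm2_weights r (w : 'cV[R]_N) : (forall n, 0 < r 0 n) ->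
  norm2 (inv_sqrt_diag r *m w) = Num.sqrt (\sum_n w n 0 ^+ 2 / r 0 n).
Proof.
move=> r_gt0; congr Num.sqrt; apply: eq_bigr => n _.
by rewrite mul_diag_mx !mxE exprMn exprVn sqr_sqrtr ?ltW// mulrC.
Qed.

(** The formula gives [w0] with [w0 n 0 / r 0 n] in the row space of [P],
    while [w - w0] is in the kernel of [P] for every other exact weight vector
    [w].  The two are orthogonal in the weighted inner product, so the squared
    norm of [w] exceeds that of [w0] by that of [w - w0] (Pythagoras). *)
Lemma is_ls_weights_unique r P m :
  (forall n, 0 <= r 0 n) -> gram_mx r P \in unitmx ->
  unique (is_ls_weights r P m) (ls_formula r P m).
Proof.
move=> r_ge0 Gu; rewrite /unique /is_ls_weights.
case: ifPn => [/forallP r_gt0|_]; last by split=> // w [].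
set w0 := ls_formula r P m.
have w0W : exact_weights P m w0.
  by rewrite /exact_weights/= /w0 /ls_formula !mulmxA mulmxV// mul1mx.
have decomp w : exact_weights P m w ->
    \sum_n w n 0 ^+ 2 / r 0 n =
    \sum_n w0 n 0 ^+ 2 / r 0 n + \sum_n (w n 0 - w0 n 0) ^+ 2 / r 0 n.
  move=> wW.
  have [a w0E] : exists a, forall n, w0 n 0 = r 0 n * (P^T *m a) n 0.
    exists (invmx (gram_mx r P) *m m) => n.
    by rewrite /w0 /ls_formula -!mulmxA mul_diag_mx mxE.
  have cross : \sum_n (P^T *m a) n 0 * (w n 0 - w0 n 0) = 0.
    transitivity ((a^T *m (P *m (w - w0))) 0 0); last first.
      by rewrite mulmxBr wW w0W subrr mulmx0 mxE.
    rewrite mulmxA [RHS]mxE; apply: eq_bigr => n _; rewrite !mxE; congr (_ * _).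
    by apply: eq_bigr => k _; rewrite !mxE mulrC.
  transitivity (\sum_n (w0 n 0 ^+ 2 / r 0 n + (w n 0 - w0 n 0) ^+ 2 / r 0 n +
                        (P^T *m a) n 0 * (w n 0 - w0 n 0) * 2)).
    apply: eq_bigr => n _; have := lt0r_neq0 (r_gt0 n); rewrite w0E => rn_neq0.
    by field.
  by rewrite !big_split/= -mulr_suml cross mul0r addr0.
have d_ge0 w n : 0 <= (w n 0 - w0 n 0) ^+ 2 / r 0 n.
  by rewrite divr_ge0 ?sqr_ge0.
split.
  split=> // w wW; rewrite !norm2_weights// ler_wsqrtr// (decomp w wW) lerDl.
  exact: sumr_ge0.
move=> w [wW /(_ w0 w0W)]; rewrite !norm2_weights// ler_sqrt; last first.
  by apply: sumr_ge0 => n _; rewrite divr_ge0 ?sqr_ge0.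
rewrite (decomp w wW) gerDl => le0.
have /eqP : \sum_n (w n 0 - w0 n 0) ^+ 2 / r 0 n = 0.
  by apply/eqP; rewrite eq_le le0 sumr_ge0.
rewrite psumr_eq0// => /allP ww0; apply/colP => n.
have := ww0 n (mem_index_enum n).
rewrite mulf_eq0 invr_eq0 [_ == 0 in X in _ || X]gt_eqF// orbF sqrf_eq0 subr_eq0.
by move=> /eqP.
Qed.

End least_squares_formula.

(** * Limits of solutions of linear systems *)

Section matrix_limits.
Context (R : realType) (T : Type) (F : set_system T) {FF : ProperFilter F}.

Lemma cvg_bigsum (I : Type) (s : seq I) (P : pred I)
    (f : I -> T -> R) (l : I -> R) :
  (forall i, P i -> f i t @[t --> F] --> l i) ->
  \sum_(i <- s | P i) f i t @[t --> F] --> \sum_(i <- s | P i) l i.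
Proof. by apply: cvg_big; exact: add_continuous. Qed.

Lemma cvg_bigprod (I : Type) (s : seq I) (P : pred I)
    (f : I -> T -> R) (l : I -> R) :
  (forall i, P i -> f i t @[t --> F] --> l i) ->
  \prod_(i <- s | P i) f i t @[t --> F] --> \prod_(i <- s | P i) l i.
Proof. by apply: cvg_big; exact: mul_continuous. Qed.

Lemma cvg_det n (A : T -> 'M[R]_n) (L : 'M[R]_n) :
  (forall i j, A t i j @[t --> F] --> L i j) ->
  (\det (A t) : R) @[t --> F] --> (\det L : R).
Proof.
move=> AL; refine (@cvg_bigsum _ _ _
  (fun (s : 'S_n) t => (-1) ^+ s * \prod_i A t i (s i)) _ _); move=> s _.
apply: cvgM; first exact: cvg_cst.
by apply: (@cvg_bigprod _ _ _ (fun i t => A t i (s i))) => i _; exact: AL.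
Qed.

Lemma cvg_adjugate n (A : T -> 'M[R]_n) (L : 'M[R]_n) :
  (forall i j, A t i j @[t --> F] --> L i j) ->
  forall i j, ((\adj (A t)) i j : R) @[t --> F] --> ((\adj L) i j : R).
Proof.
move=> AL i j; rewrite mxE; under eq_cvg do rewrite mxE.
refine (cvgM (cvg_cst _) _).
refine (@cvg_det _ (fun t => row' j (col' i (A t))) _ _).
by move=> k l; rewrite !mxE; under eq_cvg do rewrite !mxE; exact: AL.
Qed.

(** By Cramer's rule the solution is a rational function of the entries. *)
Lemma cvg_linear_solution n (A : T -> 'M[R]_n) (L : 'M[R]_n) (m e : 'cV[R]_n) :
  (forall i j, A t i j @[t --> F] --> L i j) ->
  L \in unitmx -> L *m e = m -> (\forall t \near F, A t \in unitmx) ->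
  forall k, ((invmx (A t) *m m) k 0 : R) @[t --> F] --> e k 0.
Proof.
move=> AL Lu Lem Au k.
have eE : e k 0 = (\det L)^-1 * \sum_j (\adj L) k j * m j 0.
  by rewrite -[e in LHS](mulKmx Lu) Lem /invmx Lu -scalemxAl mxE [in LHS]mxE.
rewrite eE.
apply: (@cvg_trans _
  (((\det (A t))^-1 * \sum_j (\adj (A t)) k j * m j 0 : R) @[t --> F])).
  apply: near_eq_cvg; near=> t.
  have At : A t \in unitmx by near: t.
  by rewrite /invmx At -scalemxAl mxE [in RHS]mxE.
apply: cvgM.
  apply: cvgV; last exact: cvg_det.
  by move: Lu; rewrite unitmxE unitfE.
apply: (@cvg_bigsum _ _ _ (fun j t => (\adj (A t)) k j * m j 0)) => j _.
apply: cvgM; last exact: cvg_cst.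
exact: cvg_adjugate.
Unshelve. all: by end_near. Qed.

End matrix_limits.

(** * Polynomials in a basis *)

Section polynomial_combinations.
Context (R : realType) (q d K : nat) (b : 'I_K -> mpoly q R).
Implicit Types (a c : 'rV[R]_K) (x : nat -> points R q).

Definition mpoly_comb a : mpoly q R := \sum_(k < K) a 0 k *: b k.

Lemma degree_le_comb a :
  (forall k, degree_le d (b k)) -> degree_le d (mpoly_comb a).
Proof.
move=> bd; rewrite /degree_le /mpoly_comb.
apply: leq_trans (mmeasure_sum _ _ _ _) _; apply/bigmax_leqP => k _.
exact: leq_trans (mmeasureZ_le _ _ _) (bd k).
Qed.

Lemma evalp_comb a N x (n : 'I_N) :
  evalp (mpoly_comb a) (x n) = (a *m colloc_mx b N x) 0 n.
Proof.
rewrite /evalp /mpoly_comb raddf_sum/= mxE; apply: eq_bigr => k _.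
by rewrite mxE mevalZ.
Qed.

Lemma mpoly_comb_eq0 a : is_basis d b -> mpoly_comb a = 0 -> a = 0.
Proof. by move=> [_ bfree _] /bfree a0; apply/rowP => k; rewrite a0 mxE. Qed.

Lemma basis_comb f : is_basis d b -> degree_le d f -> exists a, f = mpoly_comb a.
Proof.
move=> [_ _ bspan] /bspan[c ->]; exists (\row_k c k).
by apply: eq_bigr => k _; rewrite mxE.
Qed.

(** A kernel vector of the Gram matrix is a polynomial of degree at most [d]
    that vanishes wherever the ratio is positive, in particular on the first
    [N0] points; unisolvence makes it zero. *)
Lemma gram_mx_colloc_unit N0 N x (rN : 'rV[R]_N) :
  is_basis d b -> unisolvent d N0 x -> (N0 <= N)%N ->
  (forall n, 0 <= rN 0 n) -> (forall n : 'I_N, (n < N0)%N -> 0 < rN 0 n) ->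
  gram_mx rN (colloc_mx b N x) \in unitmx.
Proof.
move=> bb uni le_N0N r_ge0 r_gt0; have [bd _ _] := bb.
rewrite -row_free_unit; apply: inj_row_free => v vG0.
apply: (mpoly_comb_eq0 bb); apply: uni; first exact: degree_le_comb.
move=> n n_lt; have nN := leq_trans n_lt le_N0N.
rewrite (evalp_comb v x (Ordinal nN)).
exact: gram_mx_ker r_ge0 vG0 _ (r_gt0 (Ordinal nN) n_lt).
Qed.

End polynomial_combinations.

Lemma basis_change_mx (R : realType) (q d K : nat) (b p : 'I_K -> mpoly q R) :
  is_basis d b -> is_basis d p ->
  exists B : 'M[R]_K, forall k, p k = mpoly_comb b (row k B).
Proof.
move=> [_ _ bspan] [pd _ _].
have [c cE] := choice (fun k => bspan _ (pd k)).
exists (\matrix_(k, l) c k l) => k; rewrite [LHS]cE.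
by apply: eq_bigr => l _; rewrite !mxE.
Qed.

Lemma colloc_mx_comb (R : realType) (q K : nat) (b p : 'I_K -> mpoly q R)
    (B : 'M[R]_K) N (x : nat -> points R q) :
  (forall k, p k = mpoly_comb b (row k B)) ->
  colloc_mx p N x = B *m colloc_mx b N x.
Proof.
by move=> pE; apply/matrixP => k n; rewrite mxE pE evalp_comb -row_mul mxE.
Qed.

(** * The limit of the Gram matrices *)

Section discrete_to_continuous.
Context (R : realType) (q d K : nat) (Omega : set (points R q))
  (omega : points R q -> R) (x : nat -> points R q) (b : 'I_K -> mpoly q R).
Hypothesis x_lim : forall u v : mpoly q R, degree_le d u -> degree_le d v ->
  (fun N : nat => volume Omega / N%:R *
    \sum_(n < N) (evalp u (x n) * evalp v (x n) * omega (x n))) @ \oo -->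
  weighted_integral Omega omega (fun y => evalp u y * evalp v y).
Hypothesis bb : is_basis d b.

Definition mass_mx : 'M[R]_K :=
  \matrix_(k, l) weighted_integral Omega omega
    (fun y => evalp (b k) y * evalp (b l) y).

Notation gramN N := (gram_mx (ls_ratios Omega omega N x) (colloc_mx b N x)).

Lemma discrete_product (a c : 'rV[R]_K) N :
  volume Omega / N%:R * \sum_(n < N) (evalp (mpoly_comb b a) (x n) *
     evalp (mpoly_comb b c) (x n) * omega (x n)) = (a *m gramN N *m c^T) 0 0.
Proof.
rewrite mul_gram_mx mulr_sumr; apply: eq_bigr => n _.
by rewrite !evalp_comb [ls_ratios _ _ _ _ _ _]mxE; ring.
Qed.

Lemma cvg_gram_mx k l : (gramN N k l : R) @[N --> \oo] --> mass_mx k l.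
Proof.
have [bd _ _] := bb; rewrite mxE.
rewrite [X in X @ _ --> _](_ : _ = (fun N : nat => volume Omega / N%:R *
  \sum_(n < N) (evalp (b k) (x n) * evalp (b l) (x n) * omega (x n)))).
  exact: x_lim.
apply/funext => N.
rewrite /gram_mx mxE mulr_sumr; apply: eq_bigr => n _.
by rewrite mul_mx_diag !mxE; ring.
Qed.

(** The discrete sums are bilinear in the two polynomials, and their limit
    inherits this. *)
Lemma weighted_integral_comb (a c : 'rV[R]_K) :
  weighted_integral Omega omega (fun y => evalp (mpoly_comb b a) y *
     evalp (mpoly_comb b c) y) = (a *m mass_mx *m c^T) 0 0.
Proof.
have [bd _ _] := bb.
have := x_lim (degree_le_comb a bd) (degree_le_comb c bd).
under eq_fun do rewrite discrete_product.
move=> /cvg_lim <- //; apply/cvg_lim => //.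
rewrite mxE; under eq_cvg do rewrite mxE.
refine (@cvg_bigsum _ _ _ _ _ _ _
  (fun j N => (a *m gramN N) 0 j * c^T j 0) _ _) => j _.
apply: cvgM; last exact: cvg_cst.
rewrite mxE; under eq_cvg do rewrite mxE.
refine (@cvg_bigsum _ _ _ _ _ _ _ (fun i N => a 0 i * gramN N i j) _ _) => i _.
apply: cvgM; [exact: cvg_cst|exact: cvg_gram_mx].
Qed.

End discrete_to_continuous.

(** * Nonnegativity of the weights *)

Section positivity.
Context (R : realType) (q d K : nat) (Omega : set (points R q))
  (omega : points R q -> R) (x : nat -> points R q) (N0 : nat)
  (b : 'I_K -> mpoly q R).
Hypothesis mOmega : measurable Omega.
Hypothesis bOmega : bounded_points Omega.
Hypothesis vOmega : (0 < lebesgue Omega)%E.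
Hypothesis omega_ge0 : forall y, Omega y -> 0 <= omega y.
Hypothesis omega_int : (@lebesgue R q).-integrable Omega (EFin \o omega).
Hypothesis x_in : forall n, Omega (x n).
Hypothesis x_uni : unisolvent d N0 x.
Hypothesis omega_gt0 : forall n, (n < N0)%N -> 0 < omega (x n).
Hypothesis x_lim : forall u v : mpoly q R, degree_le d u -> degree_le d v ->
  (fun N : nat => volume Omega / N%:R *
    \sum_(n < N) (evalp u (x n) * evalp v (x n) * omega (x n))) @ \oo -->
  weighted_integral Omega omega (fun y => evalp u y * evalp v y).
Hypothesis bb : is_basis d b.
Notation r N := (ls_ratios Omega omega N x).
Notation M := (mass_mx Omega omega b).

Lemma ls_ratios_ge0 N n : 0 <= r N 0 n.
Proof. by rewrite mxE divr_ge0// mulr_ge0 ?omega_ge0// ltW// volume_gt0. Qed.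

Lemma ls_ratios_gt0 N (n : 'I_N) : (n < N0)%N -> 0 < r N 0 n.
Proof.
move=> nN0; rewrite mxE divr_gt0// ?mulr_gt0 ?omega_gt0 ?volume_gt0//.
by rewrite ltr0n (leq_ltn_trans _ (ltn_ord n)).
Qed.

Lemma gram_mx_ratios_unit N (p : 'I_K -> mpoly q R) :
  is_basis d p -> (N0 <= N)%N ->
  gram_mx (r N) (colloc_mx p N x) \in unitmx.
Proof.
move=> pb le_N0N; apply: (gram_mx_colloc_unit pb x_uni le_N0N).
  exact: ls_ratios_ge0.
exact: ls_ratios_gt0.
Qed.

(** The integral of [p k] is that of the product of [p k] and the constant 1,
    hence an entry of the bilinear form of the mass matrix. *)
Lemma moments_comb (e : 'rV[R]_K) (p : 'I_K -> mpoly q R) (B : 'M[R]_K) :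
  1 = mpoly_comb b e -> (forall k, p k = mpoly_comb b (row k B)) ->
  moments p Omega omega = B *m (M *m e^T).
Proof.
move=> oneE pE; apply/colP => k; rewrite [LHS]mxE.
rewrite (_ : evalp (p k) = fun y =>
    evalp (mpoly_comb b (row k B)) y * evalp (mpoly_comb b e) y).
  by rewrite (weighted_integral_comb x_lim bb) -!row_mul -mulmxA [LHS]mxE.
by apply/funext => y; rewrite -oneE -pE /evalp meval1 mulr1.
Qed.

(** A kernel vector of the mass matrix is a polynomial whose square has zero
    integral; a nonzero one would make all integrals vanish. *)
Lemma mass_mx_unit : (exists2 u : mpoly q R, degree_le d u &
    weighted_integral Omega omega (evalp u) != 0) -> M \in unitmx.
Proof.
move=> [u ud u_neq0]; rewrite -row_free_unit; apply: inj_row_free => v vM0.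
apply: (mpoly_comb_eq0 bb); apply: contra_neq_eq u_neq0 => p_neq0.
apply: (weighted_integral_sqr_eq0 u mOmega bOmega omega_ge0 omega_int p_neq0).
by rewrite (weighted_integral_comb x_lim bb) vM0 mul0mx mxE.
Qed.

(** With [a N] the solution of the normal equations, the weight at [x n] is
    [r N 0 n] times the value at [x n] of the polynomial with coefficients
    [a N].  These coefficients converge to those of the constant 1, and the
    basis is bounded on [Omega], so that value is within 1 of 1 for all [n] at
    once. *)
Lemma ls_formula_eventually_ge0 (e : 'rV[R]_K) :
  1 = mpoly_comb b e -> M \in unitmx ->
  \forall N \near \oo, forall n,
    0 <= ls_formula (r N) (colloc_mx b N x) (M *m e^T) n 0.
Proof.
move=> oneE Mu.
have [C bC] : exists C : 'I_K -> R,
    forall k y, Omega y -> `|evalp (b k) y| <= C k.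
  have bd k : exists C, forall y, Omega y -> `|evalp (b k) y| <= C.
    by have [C _ bC] := bounded_evalp (b k) bOmega; exists C.
  by have [C bC] := choice bd; exists C.
pose a N := invmx (gram_mx (r N) (colloc_mx b N x)) *m (M *m e^T).
have a_lim k : (a N k 0 : R) @[N --> \oo] --> e^T k 0.
  refine (@cvg_linear_solution _ _ \oo _ _ _ M _ _ _ Mu _ _ k) => //.
    exact: (cvg_gram_mx x_lim bb).
  by exists N0 => // N; exact: gram_mx_ratios_unit.
have err_lim : \sum_k C k * `|a N k 0 - e 0 k| @[N --> \oo] --> (0 : R).
  rewrite [X in _ --> X](_ : _ = \sum_(k < K) C k * `|e^T k 0 - e 0 k|); last first.
    by rewrite big1// => k _; rewrite mxE subrr normr0 mulr0.
  refine (@cvg_bigsum _ _ _ _ _ _ _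
    (fun k N => C k * `|a N k 0 - e 0 k|) _ _) => k _.
  apply: cvgM; first exact: cvg_cst.
  apply: cvg_norm; apply: cvgB; [exact: a_lim|exact: cvg_cst].
near=> N => n.
have err : \sum_k C k * `|a N k 0 - e 0 k| < 1.
  by near: N; apply: (cvgr_lt _ err_lim); exact: ltr01.
rewrite /ls_formula -mulmxA -/(a N) -mulmxA mul_diag_mx mxE.
rewrite mulr_ge0 ?ls_ratios_ge0//.
have -> : ((colloc_mx b N x)^T *m a N) n 0 =
    1 + \sum_k evalp (b k) (x n) * (a N k 0 - e 0 k).
  have <- : evalp (mpoly_comb b e) (x n) = 1 by rewrite -oneE /evalp meval1.
  rewrite evalp_comb !mxE -big_split/=; apply: eq_bigr => k _.
  by rewrite !mxE; ring.
rewrite -lerBlDl sub0r lerNl -[leRHS]/1; apply: le_trans (ltW err).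
apply: le_trans (ler_norm _) _; rewrite normrN.
apply: le_trans (ler_norm_sum _ _ _) _; apply: ler_sum => k _.
by rewrite normrM ler_wpM2r// bC.
Unshelve. all: by end_near. Qed.

End positivity.

Theorem theorem4p1 (R : realType) (q d : nat)
    (Omega : set (points R q)) (omega : points R q -> R)
    (x : nat -> points R q) (N0 : nat)
    (mOmega : measurable Omega)
    (bOmega : bounded_points Omega)
    (vOmega : (0 < lebesgue Omega)%E)
    (omega_ge0 : forall y, Omega y -> 0 <= omega y)
    (omega_int : (@lebesgue R q).-integrable Omega (EFin \o omega))
    (x_in : forall n, Omega (x n))
    (x_inj : injective x)
    (x_uni : unisolvent d N0 x)
    (omega_gt0 : forall n, (n < N0)%N -> 0 < omega (x n))
    (x_lim : forall u v : mpoly q R, degree_le d u -> degree_le d v ->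
      (fun N : nat => volume Omega / N%:R *
        \sum_(n < N) (evalp u (x n) * evalp v (x n) * omega (x n))) @ \oo -->
      weighted_integral Omega omega (fun y => evalp u y * evalp v y)) :
  exists N1 : nat, (N0 <= N1)%N /\
    forall N : nat, (N1 <= N)%N ->
    forall p : 'I_('C(d + q, q)) -> mpoly q R, is_basis d p ->
    exists w : 'cV[R]_N,
      unique (is_ls_weights (ls_ratios Omega omega N x) (colloc_mx p N x)
                (moments p Omega omega)) w /\
      forall n : 'I_N, 0 <= w n 0.
Proof.
(* The bound on N must serve all bases, so it is found for one basis [b]. *)
have [[b bb]|nb] :=
    pselect (exists b : 'I_('C(d + q, q)) -> mpoly q R, is_basis d b); last first.
  by exists N0; split=> // N _ p pb; case: nb; exists p.
have deg1 : degree_le d (1 : mpoly q R) by rewrite /degree_le mmeasure1.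
have [e oneE] := basis_comb bb deg1.
pose m := mass_mx Omega omega b *m e^T.
suff [N1 _ N1P] : \forall N \near \oo, forall n,
    0 <= ls_formula (ls_ratios Omega omega N x) (colloc_mx b N x) m n 0.
  exists (maxn N0 N1); split; first exact: leq_maxl.
  move=> N; rewrite geq_max => /andP[N0N N1N] p pb.
  have rge0 n : 0 <= ls_ratios Omega omega N x 0 n by exact: ls_ratios_ge0.
  have Gu (p' : 'I_('C(d + q, q)) -> mpoly q R) (p'b : is_basis d p') :=
    gram_mx_ratios_unit mOmega bOmega vOmega omega_ge0 x_in x_uni omega_gt0
      p'b N0N.
  have [Gp Gb] := (Gu p pb, Gu b bb).
  have [B pE] := basis_change_mx bb pb.
  exists (ls_formula (ls_ratios Omega omega N x) (colloc_mx p N x)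
            (moments p Omega omega)).
  split; first exact: is_ls_weights_unique.
  move=> n; rewrite (moments_comb x_lim bb oneE pE) (colloc_mx_comb _ _ pE).
  rewrite ls_formula_base_change ?Gb//; first exact: N1P.
  by move: Gp; rewrite (colloc_mx_comb _ _ pE) /gram_mx -!mulmxA unitmx_mul;
    case/andP.
have [m0|m_neq0] := eqVneq m 0.
  by exists 0 => // N _ n; rewrite m0 /ls_formula mulmx0 mxE.
apply: (ls_formula_eventually_ge0 mOmega bOmega vOmega omega_ge0 x_in x_uni
          omega_gt0 x_lim bb oneE).
apply: (mass_mx_unit mOmega bOmega omega_ge0 omega_int x_lim bb).
apply: contrapT => nu; case/eqP: m_neq0.
(* Otherwise all polynomials of degree at most d have integral zero, but [m]
   is the vector of moments of [b]. *)
have bE k : b k = mpoly_comb b (row k 1%:M).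
  rewrite /mpoly_comb (bigD1 k)//= !mxE eqxx scale1r big1 ?addr0// => l lk.
  by rewrite !mxE eq_sym (negbTE lk) scale0r.
rewrite -[m]mul1mx -(moments_comb x_lim bb oneE bE); apply/colP => k.
rewrite !mxE; apply: contrapT => /eqP bk; apply: nu; exists (b k) => //.
by case: bb.
Qed.
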